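(* Let $d\ge1$ be an integer, $\mu>-\frac12$, let $0\le m\le n$ be integers, let $p>2n+2\mu+d$, and let $\{P_{\mathbf k}:|\mathbf k|=m,\ \mathbf k\in\mathbb N_0^d\}$ be an orthonormal basis of $\mathcal V_m(\mathbb B^d,\mathsf w_\mu)$. Then for every $\mathbf k$ with $|\mathbf k|=m$ the polynomial $N_{\mathbf k,n}^{(\mu,p)}$ satisfies the differential-difference equation $$L_{\mu,p}\left[N_{\mathbf k,n}^{(\mu,p)}\right]=n(n+2\mu+d-p)\,N_{\mathbf k,n}^{(\mu,p)}-(n-m)(p-2\mu-m-n-d)\,N_{\mathbf k,n-1}^{(\mu,p-2)},$$ where $$L_{\mu,p}=t^2\frac{\partial^2}{\partial t^2}+\big(2t\langle x,\nabla_x\rangle+(1+2\mu+d-p)t\big)\frac{\partial}{\partial t}+(2\mu+d-p)\langle x,\nabla_x\rangle+\langle x,\nabla_x\rangle^2,$$ and the last term of the equation is read as $0$ when $m=n$.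
   Context: Univariate polynomials: $N_n^{(p)}(x)=(-1)^nx^pe^{1/x}\frac{d^n}{dx^n}\left(x^{-p+2n}e^{-1/x}\right)$, a polynomial of degree at most $n$ in $x$. Unit ball: $\mathbb B^d=\{x\in\mathbb R^d:\|x\|\le1\}$, $\mathsf w_\mu(x)=(1-\|x\|^2)^{\mu-1/2}$. $\mathcal V_m(\mathbb B^d,\mathsf w_\mu)$ is the space of polynomials of degree at most $m$ in $d$ variables orthogonal to all polynomials of degree less than $m$ with respect to $\mathsf w_\mu(x)\,dx$ on $\mathbb B^d$ (normalized to a probability measure). With $\alpha=\mu+\frac{d-1}{2}$, for $|\mathbf k|=m\le n$, $$N_{\mathbf k,n}^{(\mu,p)}(x,t)=N_{n-m}^{(p-2\alpha-2m)}(t)\;t^mP_{\mathbf k}\!\left(\frac xt\right),$$ where $t^mP_{\mathbf k}(x/t)$ is regarded as a homogeneous polynomial of degree $m$ in $(x,t)\in\mathbb R^d\times\mathbb R$. $\nabla_x$ is the gradient in $x$, $\langle x,\nabla_x\rangle=\sum_{i=1}^dx_i\partial_{x_i}$, and $\langle x,\nabla_x\rangle^2$ is the composition of this operator with itself. *)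

(* Defs.v *)
From HB Require Import structures.
From mathcomp Require Import all_boot all_order all_algebra.
(* [mpoly] has to come before the analysis library: in the other order their
   notations clash. *)
From mathcomp Require Import mpoly.
From mathcomp Require Import all_classical all_reals all_analysis.
From mathcomp Require Import zify ring lra.

Set Implicit Arguments.
Unset Strict Implicit.
Unset Printing Implicit Defensive.

Import Order.TTheory GRing.Theory Num.Theory.
Import numFieldNormedType.Exports.

Local Open Scope ring_scope.

Section LebesgueTuple.
Variable R : realType.
(* R with its Borel sigma-algebra; n.-tuple mR then carries the product
   sigma-algebra. *)
Local Notation mR := (measurableTypeR R).

Definition consv n (x : mR * n.-tuple mR) : n.+1.-tuple mR :=
  [tuple of x.1 :: x.2].

Lemma measurable_consv n : measurable_fun [set: mR * n.-tuple mR] (@consv n).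
Proof. by apply: measurable_cons; [exact: measurable_fst|exact: measurable_snd]. Qed.

(* Lebesgue measure on R^n; lebesgue_tuple_box gives its value on boxes. *)
Fixpoint lebesgue_tuple n : set (n.-tuple mR) -> \bar R :=
  match n with
  | 0%N => dirac [tuple]
  | n'.+1 =>
      pushforward (lebesgue_measure \x @lebesgue_tuple n')%E (@consv n')
  end.
Arguments lebesgue_tuple n : clear implicits.

Lemma lebesgue_tuple_packed n :
  exists nu : {sigma_finite_measure set (n.-tuple mR) -> \bar R},
    lebesgue_tuple n = nu.
Proof.
elim: n => [|n [nu IH]] /=.
  by exists (dirac [tuple] : {sigma_finite_measure set (0.-tuple mR) -> \bar R}).
rewrite IH.
pose lam : {sigma_finite_measure set mR -> \bar R} := @lebesgue_measure R.
pose prodm : {measure set (mR * n.-tuple mR)%type -> \bar R} := (lam \x nu)%E.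
have [F TF Foo] : sigma_finite setT prodm.
  have /sigma_finiteP[F [TF ndF Foo]] := sigma_finiteT lam.
  have /sigma_finiteP[G [TG ndG Goo]] := sigma_finiteT nu.
  exists (fun n => F n `*` G n)%classic.
    rewrite -setXTT TF TG predeqE => -[x y]; split.
      move=> [/= [i _ Fnx] [k _ Gky]]; exists (maxn i k) => //; split.
      - by move: x Fnx; exact/subsetPset/ndF/leq_maxl.
      - by move: y Gky; exact/subsetPset/ndG/leq_maxr.
    by move=> [i _ []/= ? ?]; split; exists i.
  move=> k; have [? ?] := Foo k; have [? ?] := Goo k.
  split; first exact: measurableX.
  by rewrite [ltLHS]product_measure1E// lte_mul_pinfty// ge0_fin_numE.
have mc := @measurable_consv n.
pose push0 : {measure set (n.+1.-tuple mR) -> \bar R} :=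
  pushforward prodm (@consv n).
pose push := push0 mc.
have sf : sigma_finite setT push.
  pose uncons (x : n.+1.-tuple mR) : mR * n.-tuple mR := (thead x, [tuple of behead x]).
  have mu_ : measurable_fun setT uncons.
    apply/measurable_fun_pair; first exact: measurable_tnth.
    exact: measurable_behead.
  have consvK : cancel (@consv n) uncons.
    by move=> [a x]; rewrite /uncons /consv theadE; congr pair; exact/val_inj.
  exists (fun i => uncons @^-1` F i)%classic.
    by rewrite -preimage_bigcup -TF preimage_setT.
  move=> i; have [mF Foo_] := Foo i; split.
    by rewrite -[X in measurable X]setTI; exact: mu_.
  rewrite /push /= /pushforward.
  rewrite (_ : (_ @^-1` _)%classic = F i)//.
  by apply/seteqP; split => x; rewrite /preimage /= consvK.
pose S := Measure_isSigmaFinite.Build _ _ _ push sf.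
pose nu' : {sigma_finite_measure set (n.+1.-tuple mR) -> \bar R} :=
  HB.pack (push : set _ -> \bar R) (Measure.class push) S.
by exists nu'.
Qed.


Let lebesgue_tuple0 n : lebesgue_tuple n set0 = 0%E.
Proof. by have [nu ->] := lebesgue_tuple_packed n; rewrite measure0. Qed.

Let lebesgue_tuple_ge0 n A : (0 <= lebesgue_tuple n A)%E.
Proof. by have [nu ->] := lebesgue_tuple_packed n; exact: measure_ge0. Qed.

Let lebesgue_tuple_sigma_additive n : semi_sigma_additive (lebesgue_tuple n).
Proof.
by have [nu ->] := lebesgue_tuple_packed n; exact: measure_semi_sigma_additive.
Qed.

HB.instance Definition _ n := isMeasure.Build _ _ _ (lebesgue_tuple n)
  (@lebesgue_tuple0 n) (@lebesgue_tuple_ge0 n)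
  (@lebesgue_tuple_sigma_additive n).

Let lebesgue_tuple_sigma_finite n : sigma_finite setT (lebesgue_tuple n).
Proof. by have [nu ->] := lebesgue_tuple_packed n; exact: sigma_finiteT. Qed.

HB.instance Definition _ n := Measure_isSigmaFinite.Build _ _ _
  (lebesgue_tuple n) (@lebesgue_tuple_sigma_finite n).

Lemma lebesgue_tuple_box n (A : 'I_n -> set mR) :
  (forall i, measurable (A i)) ->
  lebesgue_tuple n [set x | forall i, A i (tnth x i)]%classic
  = (\prod_(i < n) lebesgue_measure (A i))%E.
Proof.
elim: n A => [|n IH] A mA.
  rewrite big_ord0 /= diracE mem_set// => i; by case: i.
rewrite big_ord_recl -IH// /= /pushforward.
have [nu E] := lebesgue_tuple_packed n; rewrite E.
have mbox : measurable
    [set x : n.-tuple mR | forall i, A (lift ord0 i) (tnth x i)]%classic.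
  rewrite (_ : mkset _ = \bigcap_(i in [set: 'I_n])
      ((fun x : n.-tuple mR => tnth x i) @^-1` A (lift ord0 i)))%classic.
    apply: fin_bigcap_measurable => // i _.
    by rewrite -[X in measurable X]setTI; exact: measurable_tnth.
  by apply/seteqP; split => [x Ax i _|x Ax i]; [exact: Ax|exact: (Ax i I)].
rewrite -[RHS]product_measure1E//.
congr (product_measure1 _ _ _); apply/seteqP; split => [[a x] /= Ax|[a x] /= Ax].
  split; first by have := Ax ord0.
  by move=> i; have := Ax (lift ord0 i); rewrite /consv tnthS.
by move=> i; case: (unliftP ord0 i) => [j|] ->;
  [rewrite /consv tnthS; case: Ax|case: Ax].
Qed.

End LebesgueTuple.

Section UnivariatePolynomials.
Variable R : realType.

Definition rodrigues (p : R) n (x : R) : R :=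
  (-1) ^+ n * x `^ p * expR x^-1 *
  ((fun y : R => y `^ (- p + 2 * n%:R) * expR (- y^-1))^`(n))%classic x.

(* The Rodrigues formula makes sense for x > 0, where it is given by a unique
   polynomial (rodrigues_is_poly, Npoly_unique); Npoly is that polynomial. *)
Definition Npoly (p : R) n : {poly R} :=
  xget 0 [set q : {poly R} | forall x, 0 < x -> q.[x] = rodrigues p n x]%classic.

Fixpoint rod_aux (q : R) k : {poly R} :=
  if k is k'.+1 then
    'X^2 * (rod_aux q k')^`() + ((q - 2 * k'%:R) *: 'X + 1) * rod_aux q k'
  else 1.

Lemma size_rod_aux q k : (size (rod_aux q k) <= k.+1)%N.
Proof.
elim: k => [|k IH] /=; first by rewrite size_poly1.
apply: (leq_trans (size_polyD _ _)); rewrite geq_max; apply/andP; split.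
  have [->|nz] := eqVneq (rod_aux q k)^`() 0; first by rewrite mulr0 size_poly0.
  rewrite size_monicM ?monicXn// size_polyXn.
  have h : (size (rod_aux q k)^`() < size (rod_aux q k))%N.
    by apply: lt_size_deriv; apply: contraNneq nz => ->; rewrite deriv0.
  by move: h IH; set a := size _; set b := size _; lia.
apply: (leq_trans (size_polyMleq _ _)).
have : (size ((q - 2 * k%:R) *: 'X + 1 : {poly R})%R <= 2)%N.
  apply: (leq_trans (size_polyD _ _)); rewrite geq_max size_poly1 andbT.
  by apply: (leq_trans (size_scale_leq _ _)); rewrite size_polyX.
move: IH; set a := size _; set b := size _ => h1 h2.
by lia.
Qed.

Lemma derive1n_rod_aux q k x : 0 < x ->
  ((fun y : R => y `^ q * expR (- y^-1))^`(k))%classic x =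
  x `^ (q - 2 * k%:R) * expR (- x^-1) * (rod_aux q k).[x].
Proof.
elim: k x => [|k IH] x x0.
  by rewrite derive1n0 /= hornerC mulr0 subr0 mulr1.
rewrite derive1nS derive1E.
rewrite (@near_eq_derive _ _ _ _ (fun y : R =>
  y `^ (q - 2 * k%:R) * expR (- y^-1) * (rod_aux q k).[y])); last first.
  by near=> y; apply: IH; near: y; exact: lt_nbhsr.
have xn0 : x != 0 by rewrite gt_eqF.
have ? := @is_derive1_powR R (q - 2 * k%:R) x x0.
have dinv : is_derive x 1 (fun y : R => y^-1) (- x ^- 2).
  apply: trigger_derive; first exact: (@is_deriveV _ id x 1 1 xn0).
  by rewrite /GRing.scale /= mulr1.
have de : is_derive x 1 (fun y : R => expR (- y^-1)) (x ^- 2 * expR (- x^-1)).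
  have h : is_derive x 1 (fun y : R => - y^-1) (- - x ^- 2).
    by apply: (@is_deriveN _ _ _ (fun y : R => y^-1)).
  have -> : x ^- 2 * expR (- x^-1) = expR (- x^-1) * (- - x ^- 2).
    by rewrite opprK mulrC.
  exact: (@is_derive1_comp _ expR (fun y : R => - y^-1)).
pose f1 := fun y : R => y `^ (q - 2 * k%:R).
pose f2 := fun y : R => expR (- y^-1).
have d12 := @is_deriveM _ _ f1 f2 x 1 _ _ _ de.
have d123 := @is_deriveM _ _ _ (horner (rod_aux q k)) x 1 _ _ (d12 _ _) _.
rewrite (_ : (fun y => _) = f1 * f2 * horner (rod_aux q k)); last by apply/funext.
have [_ ->] := d123 _ _ _.
rewrite /f1 /f2 !fctE /GRing.scale /= !hornerE.
have E1 : x `^ (q - 2 * k%:R - 1) = x `^ (q - 2 * k.+1%:R) * x.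
  rewrite -[X in _ = _ * X](powRr1 (ltW x0)) -powRD; last by rewrite xn0 implybT.
  by congr powR; rewrite -natr1; ring.
have E2 : x `^ (q - 2 * k%:R) = x `^ (q - 2 * k.+1%:R) * x ^+ 2.
  rewrite -(powR_mulrn _ (ltW x0)) -powRD; last by rewrite xn0 implybT.
  by congr powR; rewrite -natr1; ring.
rewrite E1 E2.
have gen (a b e u v : R) : a * x ^+ 2 * e * v +
    u * (a * x ^+ 2 * x ^- 2 * e + e * b * (a * x)) =
    a * e * (x ^+ 2 * v + (b * x + 1) * u) by field.
exact: gen.
Unshelve. all: by end_near. Qed.

Lemma rodrigues_is_poly (p : R) n :
  exists2 q : {poly R}, (size q <= n.+1)%N &
    forall x, 0 < x -> q.[x] = rodrigues p n x.
Proof.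
exists ((-1) ^+ n *: rod_aux (- p + 2 * n%:R) n).
  by apply: (leq_trans (size_scale_leq _ _)); exact: size_rod_aux.
move=> x x0; rewrite hornerZ /rodrigues derive1n_rod_aux//.
have -> : - p + 2 * n%:R - 2 * n%:R = - p :> R by ring.
have h1 : x `^ p * x `^ (- p) = 1 by rewrite powRN divff// powR_eq0 gt_eqF.
have h2 : expR x^-1 * expR (- x^-1) = 1 by rewrite -expRD subrr expR0.
rewrite -[LHS]mulr1 -h1 -[LHS]mulr1 -h2.
by ring.
Qed.

Lemma poly_eq_pos (q1 q2 : {poly R}) :
  (forall x, 0 < x -> q1.[x] = q2.[x]) -> q1 = q2.
Proof.
move=> q12; apply/eqP; rewrite -subr_eq0; apply: contraT => nz.
pose s := [seq (i.+1)%:R : R | i <- iota 0 (size (q1 - q2))].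
have := max_poly_roots nz (rs := s).
rewrite size_map size_iota ltnn; apply.
  apply/allP => _ /mapP[i _ ->]; rewrite /root hornerD hornerN.
  have i0 : 0 < i.+1%:R :> R by rewrite ltr0n.
  by rewrite (q12 _ i0) subrr.
by rewrite map_inj_uniq ?iota_uniq// => i j /eqP; rewrite eqr_nat => /eqP[].
Qed.

Lemma NpolyE (p : R) n x : 0 < x -> (Npoly p n).[x] = rodrigues p n x.
Proof.
rewrite /Npoly; case: xgetP => [q _ qP|noq]; first exact: qP.
by have [q _ qP] := rodrigues_is_poly p n; have := noq q qP.
Qed.

Lemma Npoly_unique (p : R) n (q : {poly R}) :
  (forall x, 0 < x -> q.[x] = rodrigues p n x) -> Npoly p n = q.
Proof. by move=> qP; apply: poly_eq_pos => x x0; rewrite NpolyE// qP. Qed.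

Lemma size_Npoly (p : R) n : (size (Npoly p n) <= n.+1)%N.
Proof.
by have [q sq qP] := rodrigues_is_poly p n; rewrite (Npoly_unique qP).
Qed.

End UnivariatePolynomials.

Section UnitBall.
Variables (R : realType) (d : nat).

Definition enorm (x : d.-tuple (measurableTypeR R)) : R :=
  Num.sqrt (\sum_(i < d) (tnth x i : R) ^+ 2).

Definition unit_ball : set (d.-tuple (measurableTypeR R)) :=
  [set x | enorm x <= 1]%classic.

Definition ball_weight (mu : R) (x : d.-tuple (measurableTypeR R)) : R :=
  (1 - enorm x ^+ 2) `^ (mu - 1 / 2).

Definition ball_inner (mu : R) (P Q : {mpoly R[d]}) : R :=
  (\int[@lebesgue_tuple R d]_(x in unit_ball)
     (P.@[tnth x] * Q.@[tnth x] * ball_weight mu x)) /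
  \int[@lebesgue_tuple R d]_(x in unit_ball) ball_weight mu x.

(* msize is the total degree plus one (and 0 for the zero polynomial). *)
Definition Vball (mu : R) (m : nat) (P : {mpoly R[d]}) : Prop :=
  (msize P <= m.+1)%N /\
  forall Q : {mpoly R[d]}, (msize Q <= m)%N -> ball_inner mu P Q = 0.

(* Only the values of P at the multi-indices of length m matter. *)
Definition orthonormal_basis_Vball (mu : R) (m : nat)
    (P : 'X_{1..d} -> {mpoly R[d]}) : Prop :=
  [/\ forall k, mdeg k = m -> Vball mu m (P k),
      forall k l, mdeg k = m -> mdeg l = m ->
        ball_inner mu (P k) (P l) = (k == l)%:R &
      forall Q, Vball mu m Q -> exists c : 'X_{1..d} -> R,
        Q = \sum_(k : 'X_{1..d < m.+1} | mdeg k == m) c k *: P k].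

End UnitBall.

(* Polynomials in (x, t) are elements of {poly {mpoly R[d]}}: the outer
   variable 'X is t, the inner variables 'X_i are the coordinates of x. *)
Section Cone.
Variables (R : realType) (d : nat).

Definition homogenize (m : nat) (P : {mpoly R[d]}) : {poly {mpoly R[d]}} :=
  \sum_(k <- msupp P) (P@_k *: 'X_[k]) *: 'X^(m - mdeg k).

Lemma homogenizeE m (P : {mpoly R[d]}) (x : 'I_d -> R) (t : R) :
  (msize P <= m.+1)%N -> t != 0 ->
  (homogenize m P).[t%:MP].@[x] = t ^+ m * P.@[fun i => x i / t].
Proof.
move=> sP t0; rewrite /homogenize horner_sum raddf_sum /= [in RHS]mevalE.
rewrite mulr_sumr big_seq [in RHS]big_seq; apply: eq_bigr => k kP.
have km : (mdeg k <= m)%N.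
  by rewrite -ltnS; apply: leq_trans (msize_mdeg_lt kP) sP.
rewrite hornerZ hornerXn mevalM mevalZ mevalX rmorphXn /= mevalC.
rewrite mulrCA -mulrA; congr (_ * _).
under [in RHS]eq_bigr do rewrite exprMn.
rewrite big_split /= mulrCA; congr (_ * _).
have -> : \prod_(i < d) t^-1 ^+ k i = t^-1 ^+ mdeg k.
  by rewrite mdegE expr_sum.
by rewrite exprVn expfB_cond ?(negbTE t0)//.
Qed.

Definition N_cone (mu p : R) (P : 'X_{1..d} -> {mpoly R[d]})
    (k : 'X_{1..d}) (n : nat) : {poly {mpoly R[d]}} :=
  let m := mdeg k in
  let alpha := mu + (d%:R - 1) / 2 in
  map_poly (@mpolyC d R) (Npoly (p - 2 * alpha - 2 * m%:R) (n - m)) *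
  homogenize m (P k).

(* <x, grad_x> *)
Definition x_grad (F : {poly {mpoly R[d]}}) : {poly {mpoly R[d]}} :=
  \sum_(i < d) ('X_i : {mpoly R[d]})%:P * map_poly (mderiv i) F.

Definition L_cone (mu p : R) (F : {poly {mpoly R[d]}}) : {poly {mpoly R[d]}} :=
  'X^2 * F^`()^`() +
  (2 * 'X * x_grad F^`() + (1 + 2 * mu + d%:R - p)%:MP *: ('X * F^`())) +
  (2 * mu + d%:R - p)%:MP *: x_grad F +
  x_grad (x_grad F).

End Cone.

(* Main.v *)
(** Let [T = t d/dt + <x, grad_x>] be the Euler operator in all [d + 1]
    variables.  Then [L = T^2 + (2 mu + d - p) T].  Since [t^m P(x/t)] is
    homogeneous of degree [m], on a product [f(t) t^m P(x/t)] the operator [T]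
    acts as [t d/dt + m] on [f] alone, so the equation reduces to an identity
    for the univariate [f = N_j^{(q)}], [j = n - m]:
      [t^2 f'' + (2 - q) t f' = j (j + 1 - q) (f + N_{j-1}^{(q-2)})].
    This combines the Bessel equation
      [t^2 f'' + ((2 - q) t + 1) f' = j (j + 1 - q) f]
    with [f' = - j (j + 1 - q) N_{j-1}^{(q-2)}]; both follow from
    [a_k' = k (r - k + 1) a_{k-1}], where
    [(y^r e^{-1/y})^{(k)} = y^{r-2k} e^{-1/y} a_k(y)]. *)
From HB Require Import structures.
Require Import Defs.
From mathcomp Require Import all_boot all_order all_algebra.
From mathcomp Require Import mpoly.
From mathcomp Require Import all_classical all_reals all_analysis.
From mathcomp Require Import ring.
Import Order.TTheory GRing.Theory Num.Theory.
Local Open Scope ring_scope.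

Section RodriguesPolynomials.
Variable R : realType.
Implicit Types (q : R) (k : nat).

Lemma rod_auxS q k : rod_aux q k.+1 =
  'X^2 * (rod_aux q k)^`() + ((q - 2 * k%:R) *: 'X + 1) * rod_aux q k.
Proof. by []. Qed.

(** In the derivative of the recurrence for [rod_aux q k.+2], the induction hypothesis with constant
    [c] gives [c] times the recurrence for [rod_aux q k.+1] plus [q - 2 * k.+1%:R] times
    [rod_aux q k.+1]; the constants add up to [k.+2%:R * (q - k.+1%:R)]. *)
Lemma deriv_rod_aux q k :
  (rod_aux q k.+1)^`() = (k.+1%:R * (q - k%:R)) *: rod_aux q k.
Proof.
elim: k => [|k IHk].
  by rewrite rod_auxS /= !poly.derivE -!mul_polyC; ring.
rewrite (rod_auxS q k.+1) derivD !derivM IHk !poly.derivE.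
rewrite (rod_auxS q k) -!mul_polyC -!natr1; ring.
Qed.

Lemma Npoly_rod_aux q k :
  Npoly q k = (-1) ^+ k *: rod_aux (- q + 2 * k%:R) k.
Proof.
apply: Npoly_unique => x x0; rewrite hornerZ /rodrigues derive1n_rod_aux//.
rewrite addrK powRN expRN.
have x_neq0 : x `^ q != 0 by rewrite powR_eq0 gt_eqF.
have e_neq0 : expR x^-1 != 0 by rewrite gt_eqF ?expR_gt0.
by field; rewrite x_neq0 e_neq0.
Qed.

Lemma deriv_Npoly q k :
  (Npoly q k.+1)^`() =
  (k.+1%:R * (q - k.+2%:R)) *: Npoly (q - 2) k.
Proof.
rewrite !Npoly_rod_aux derivZ deriv_rod_aux exprS.
(* Lowering the degree by 1 and [q] by 2 leaves the parameter of [rod_aux] fixed. *)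
have -> : - (q - 2) + 2 * k%:R = - q + 2 * k.+1%:R :> R.
  by rewrite -natr1; ring.
rewrite !scalerA; congr (_ *: _); rewrite -!natr1; ring.
Qed.

Lemma Npoly0 q : Npoly q 0 = 1.
Proof. by rewrite Npoly_rod_aux expr0 scale1r. Qed.

(** For degree [k.+1] the first derivative is a multiple of [rod_aux r k] with
    [r = - q + 2 * k.+1%:R]. Since [r - 2 * k%:R = 2 - q], the left side is that multiple of the
    recurrence for [rod_aux r k.+1]. *)
Lemma Npoly_bessel q k :
  'X^2 * (Npoly q k)^`()^`() + ((2 - q) *: 'X + 1) * (Npoly q k)^`() =
  (k%:R * (k.+1%:R - q)) *: Npoly q k.
Proof.
case: k => [|k]; first by rewrite Npoly0 !poly.derivE mul0r scale0r; ring.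
rewrite !Npoly_rod_aux !derivZ deriv_rod_aux derivZ.
rewrite (rod_auxS _ k) -!mul_polyC -!natr1; ring.
Qed.

Lemma Npoly_diff_difference q k :
  'X^2 * (Npoly q k)^`()^`() + (2 - q) *: ('X * (Npoly q k)^`()) =
  (k%:R * (k.+1%:R - q)) *:
    (Npoly q k + (if (0 < k)%N then Npoly (q - 2) k.-1 else 0)).
Proof.
case: k => [|k].
  by rewrite Npoly0 !poly.derivE mul0r !scale0r -mul_polyC; ring.
rewrite /= scalerDr -Npoly_bessel deriv_Npoly -!mul_polyC -!natr1; ring.
Qed.

End RodriguesPolynomials.

Section Euler.
Variables (R : realType) (d : nat).
Implicit Types (F G H : {poly {mpoly R[d]}}) (P Q : {mpoly R[d]}).

Definition euler P : {mpoly R[d]} := \sum_(i < d) 'X_i * mderiv i P.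

(** As [t] is a constant for [x_grad], rules for [x_grad] reduce to rules for [euler] on
    coefficients. *)
Lemma coef_x_grad F j : (x_grad F)`_j = euler F`_j.
Proof.
rewrite /x_grad coef_sum; apply: eq_bigr => i _.
by rewrite coefCM coef_map.
Qed.

Lemma eulerM P Q : euler (P * Q) = euler P * Q + P * euler Q.
Proof.
rewrite /euler mulr_suml mulr_sumr -big_split; apply: eq_bigr => i _ /=.
rewrite mderivM; ring.
Qed.

Lemma euler_is_linear : linear euler.
Proof.
move=> c P Q; rewrite /euler scaler_sumr -big_split; apply: eq_bigr => i _ /=.
by rewrite linearP mulrDr scalerAr.
Qed.

HB.instance Definition _ := GRing.isLinear.Build R {mpoly R[d]} {mpoly R[d]} _
  euler euler_is_linear.

Lemma eulerC (c : R) : euler c%:MP = 0.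
Proof. by rewrite /euler big1// => i _; rewrite mderivC mulr0. Qed.

Lemma eulerX (k : 'X_{1..d}) : euler 'X_[k] = (mdeg k)%:R *: 'X_[k].
Proof.
rewrite mdegE natr_sum scaler_suml; apply: eq_bigr => i _.
rewrite mderivX -scalerAr -mpolyXD.
(* Subtraction of multi-indices truncates when [k i = 0], but then the factor [k i] vanishes. *)
have [->|ki] := eqVneq (k i) 0%N; first by rewrite !scale0r.
rewrite addmC submK//; apply/mnm_lepP => j.
by rewrite mnm1E; case: eqVneq => // <-; rewrite lt0n.
Qed.

Lemma x_gradM F G : x_grad (F * G) = x_grad F * G + F * x_grad G.
Proof.
apply/polyP => j; rewrite coefD coef_x_grad !coefM raddf_sum -big_split.
by apply: eq_bigr => i _ /=; rewrite eulerM !coef_x_grad.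
Qed.

Lemma x_gradD F G : x_grad (F + G) = x_grad F + x_grad G.
Proof. by apply/polyP => j; rewrite !(coefD, coef_x_grad) raddfD. Qed.

Lemma x_grad0 : x_grad 0 = 0 :> {poly {mpoly R[d]}}.
Proof. by apply/polyP => j; rewrite coef_x_grad coef0 raddf0. Qed.

Lemma x_grad_map (f : {poly R}) : x_grad (map_poly (@mpolyC d R) f) = 0.
Proof. by apply/polyP => j; rewrite coef_x_grad coef_map coef0 eulerC. Qed.

Lemma x_grad_deriv F : x_grad F^`() = (x_grad F)^`().
Proof.
by apply/polyP => j; rewrite !(coef_x_grad, coef_deriv) raddfMn.
Qed.

Definition cone_euler F := 'X * F^`() + x_grad F.

Lemma cone_eulerD F G : cone_euler (F + G) = cone_euler F + cone_euler G.
Proof. by rewrite /cone_euler derivD x_gradD; ring. Qed.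

Lemma cone_euler0 : cone_euler 0 = 0.
Proof. by rewrite /cone_euler deriv0 x_grad0; ring. Qed.

Lemma cone_eulerM F G :
  cone_euler (F * G) = cone_euler F * G + F * cone_euler G.
Proof. by rewrite /cone_euler derivM x_gradM; ring. Qed.

Lemma x_gradX : x_grad 'X = 0 :> {poly {mpoly R[d]}}.
Proof. by rewrite -(map_polyX (@mpolyC d R)) x_grad_map. Qed.

(** [x_grad] commutes with [d/dt] and kills [t]. Squaring [cone_euler] thus gives the mixed term of
    [L_cone] and one extra [t d/dt], the 1 in [1 + 2 * mu + d%:R - p]. *)
Lemma L_coneE mu p F :
  L_cone mu p F =
  cone_euler (cone_euler F) + (2 * mu + d%:R - p)%:MP *: cone_euler F.
Proof.
rewrite /L_cone /cone_euler derivD derivM derivX x_gradD x_gradM x_gradX.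
rewrite x_grad_deriv -!mul_polyC; ring.
Qed.

(** On each term [x^k t^(m - |k|)], [x_grad] contributes [|k|] and [t d/dt] contributes [m - |k|];
    the degree bound keeps this subtraction from truncating. *)
Lemma cone_euler_homogenize (m : nat) P : (msize P <= m.+1)%N ->
  cone_euler (homogenize m P) = m%:R *: homogenize m P.
Proof.
move=> Pm; rewrite /homogenize big_seq scaler_sumr.
rewrite (big_morph _ cone_eulerD cone_euler0); apply: eq_bigr => k kP.
have km : (mdeg k <= m)%N.
  by rewrite -ltnS; apply: leq_trans (msize_mdeg_lt kP) Pm.
have -> : m%:R = (mdeg k)%:R + (m - mdeg k)%:R :> {mpoly R[d]}.
  by rewrite -natrD subnKC.
rewrite /cone_euler derivZ derivXn -scalerAr mulrnAr.
have -> : x_grad ((P@_k *: 'X_[k]) *: 'X^(m - mdeg k)) =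
   (mdeg k)%:R *: ((P@_k *: 'X_[k]) *: 'X^(m - mdeg k)).
  apply/polyP => j; rewrite coef_x_grad !coefZ coefXn.
  case: eqP => _; last by rewrite !mulr0 raddf0.
  by rewrite !mulr1 linearZ /= eulerX -scalerAr scaler_nat mulr_natl.
rewrite scalerDl addrC; congr (_ + _).
rewrite scaler_nat -scalerMnr; case: (m - mdeg k)%N => [|j].
  by rewrite !mulr0n.
by rewrite /= -exprS.
Qed.

Lemma cone_euler_map (f : {poly R}) :
  cone_euler (map_poly (@mpolyC d R) f) = map_poly (@mpolyC d R) ('X * f^`()).
Proof.
by rewrite /cone_euler x_grad_map addr0 deriv_map rmorphM /= map_polyX.
Qed.

(** With [D = t d/dt] and [c = 2 mu + d - p], this is [(D + m)^2 + c (D + m) = D^2 + (2 m + c) D + m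
    (m + c)], where [D^2 f = t^2 f'' + t f']. *)
Lemma L_cone_map_mul (mu p : R) (m : nat) (f : {poly R}) H :
  cone_euler H = m%:R *: H ->
  L_cone mu p (map_poly (@mpolyC d R) f * H) =
  map_poly (@mpolyC d R)
    ('X^2 * f^`()^`() + (1 + 2 * m%:R + (2 * mu + d%:R - p)) *: ('X * f^`()) +
     (m%:R * (m%:R + (2 * mu + d%:R - p))) *: f) * H.
Proof.
move=> TH.
have T g : cone_euler (map_poly (@mpolyC d R) g * H) =
    map_poly (@mpolyC d R) ('X * g^`() + m%:R *: g) * H.
  rewrite cone_eulerM TH cone_euler_map rmorphD /=.
  by rewrite [map_poly _ (_ *: _)]map_polyZ /= rmorph_nat -!mul_polyC; ring.
rewrite L_coneE !T -[_%:MP *: _]mul_polyC mulrA -map_polyC.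
rewrite -rmorphM -mulrDl -rmorphD /=.
congr (map_poly _ _ * _).
rewrite derivD derivM derivX derivZ -!mul_polyC; ring.
Qed.

End Euler.

Theorem theorem3p6 (R : realType) (d : nat) (hd : (1 <= d)%N)
    (mu : R) (hmu : - (1 / 2) < mu)
    (m n : nat) (hmn : (m <= n)%N)
    (p : R) (hp : 2 * n%:R + 2 * mu + d%:R < p)
    (P : 'X_{1..d} -> {mpoly R[d]}) (hP : orthonormal_basis_Vball mu m P)
    (k : 'X_{1..d}) (hk : mdeg k = m) :
  L_cone mu p (N_cone mu p P k n) =
    (n%:R * (n%:R + 2 * mu + d%:R - p))%:MP *: N_cone mu p P k n
    - (if (m < n)%N then
         ((n%:R - m%:R) * (p - 2 * mu - m%:R - n%:R - d%:R))%:MP *: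
           N_cone mu (p - 2) P k (n - 1)
       else 0).
Proof.
have sP : (msize (P k) <= m.+1)%N by case: hP => /(_ k hk)[].
have TP := cone_euler_homogenize _ _ _ _ sP.
rewrite /N_cone hk (L_cone_map_mul _ _ _ _ _ _ _ TP).
set q := p - 2 * _ - _.
have qE : p = q + 2 * mu + d%:R - 1 + 2 * m%:R by rewrite /q; field.
have -> : p - 2 - 2 * (mu + (d%:R - 1) / 2) - 2 * m%:R = q - 2.
  by rewrite /q; ring.
have -> : 1 + 2 * m%:R + (2 * mu + d%:R - p) = 2 - q by rewrite qE; ring.
rewrite Npoly_diff_difference.
have nE : n%:R = (n - m)%:R + m%:R :> R by rewrite -natrD subnK.
(* With [j = n - m] and [c = 2 mu + d - p = 1 - q - 2 m], the coefficients agree because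
   [j (j + 1 - q) + m (m + c) = n (n + c)] and [p - 2 mu - m - n - d = - (j + 1 - q)]. *)
rewrite subn_gt0 subnAC subn1 nE qE; clear -hmn.
move: (n - m)%N => j.
case: ifP => _; rewrite -!mul_polyC !mulrA -!map_polyC -!rmorphM;
  rewrite -?mulrBl -?rmorphB ?subr0 /=; congr (map_poly _ _ * _);
  rewrite -?mul_polyC -?natr1; ring.
Qed.
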